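(* Let $A$ be a totally ordered alphabet. Then the left-greedy bracketings $\lfloor\!\lfloor w\rfloor\!\rfloor$, as $w$ ranges over all Lyndon-Shirshov words in $A$, form a linear basis of the free Lie algebra on $A$.
   Context: **Lie algebras.** A Lie algebra is a vector space with a bilinear bracket $[\cdot,\cdot]$ satisfying anti-commutativity $[a,b]+[b,a]=0$ and the Jacobi identity $[a,[b,c]]+[c,[a,b]]+[b,[c,a]]=0$. The free Lie algebra on $A$ is the Lie algebra generated by the letters of $A$ whose bracket satisfies no relations other than those following from these two. **Words.** A word is a finite nonempty string of letters of $A$; words are ordered lexicographically. A word $w$ is a Lyndon-Shirshov word if it is lexicographically strictly less than all of its cyclic permutations, i.e. $w<vu$ for every factorization $w=uv$ with $u,v$ nonempty (single letters are Lyndon-Shirshov words). **Simple partitions and full partitions.** Given a letter $a$, an $a$-simple word is a word $a^n x$ with $n\ge 0$ and $x$ a single letter, $x\ne a$. A simple partition of a word $w$ with first letter $a$ is an expression $w=\alpha_1\alpha_2\cdots\alpha_k$ as a concatenation of $a$-simple words; it is unique if it exists. Regard the blocks $\alpha_i$ as letters of a new alphabet (the alphabet of words), so that $\alpha_1\cdots\alpha_k$ is a word of words which may itself have a simple partition (into $\alpha_1$-simple words $\alpha_1^n\chi$, with $\chi$ a block, $\chi\neq\alpha_1$), and so on. The word $w$ fully partitions if iterating this finitely many times reaches the partition of $w$ with a single block. A one-letter word is already a single block. Every Lyndon-Shirshov word fully partitions, and the resulting nested partition is unique. **Left-greedy bracketing.** For a fully partitioned word, define a bracket expression for each block of each level recursively: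 for a single letter $x$ (level 0), $\lfloor\!\lfloor x\rfloor\!\rfloor=x$; for a block $\alpha^n\chi$ formed from blocks $\alpha\neq\chi$ of the previous level, $n\ge 0$, $$\lfloor\!\lfloor \alpha^n\chi\rfloor\!\rfloor=\bigl[\lfloor\!\lfloor\alpha\rfloor\!\rfloor,\bigl[\lfloor\!\lfloor\alpha\rfloor\!\rfloor,\ldots\bigl[\lfloor\!\lfloor\alpha\rfloor\!\rfloor,\lfloor\!\lfloor\chi\rfloor\!\rfloor\bigr]\cdots\bigr]\bigr]$$ with $n$ copies of $\lfloor\!\lfloor\alpha\rfloor\!\rfloor$ (so $\lfloor\!\lfloor\alpha^0\chi\rfloor\!\rfloor=\lfloor\!\lfloor\chi\rfloor\!\rfloor$). Then $\lfloor\!\lfloor w\rfloor\!\rfloor$ is the expression of the final single block, regarded as an element of the free Lie algebra on $A$. Example: $\lfloor\!\lfloor aababb\rfloor\!\rfloor=[[[a,[a,b]],[a,b]],b]$.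
   Formalization: Over a field of characteristic 2 a Lie algebra is also required to satisfy [x,x]=0; with only anti-commutativity and Jacobi the claim fails there (for one letter x, [x,x] is nonzero and outside the span). In other characteristics nothing changes. *)

(* Defs.v *)
From HB Require Import structures.
From mathcomp Require Import all_boot all_order all_algebra.
From mathcomp Require Import boolp classical_sets.
Set Implicit Arguments. Unset Strict Implicit. Unset Printing Implicit Defensive.
Import Order.TTheory GRing.Theory.
Local Open Scope ring_scope.
Local Open Scope quotient_scope.

Definition linear_basis (k : fieldType) (V : lmodType k) (I : eqType)
    (b : I -> V) : Prop :=
  (forall (s : seq I) (c : I -> k), uniq s ->
     \sum_(i <- s) c i *: b i = 0 -> {in s, forall i, c i = 0}) /\
  (forall v : V, exists (s : seq I) (c : I -> k), v = \sum_(i <- s) c i *: b i).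

(* In characteristic <> 2, [x, x] = 0 follows from anti-commutativity (see
   lie_bracketxx) and the hypothesis 2 = 0 makes the field [lie_alt2] vacuous.
   In characteristic 2 the condition [x, x] = 0 is part of the usual definition;
   without it, for a letter x, [x, x] would be a nonzero element of the free Lie
   algebra outside the span of the left-greedy bracketings. *)
HB.mixin Record isLieAlgebra (k : fieldType) L & GRing.Lmodule k L := {
  lie_bracket : L -> L -> L;
  lie_bracketPl : forall (a : k) x y z,
    lie_bracket (a *: x + y) z = a *: lie_bracket x z + lie_bracket y z;
  lie_bracketPr : forall (a : k) x y z,
    lie_bracket z (a *: x + y) = a *: lie_bracket z x + lie_bracket z y;
  lie_anticomm : forall x y, lie_bracket x y + lie_bracket y x = 0;
  lie_jacobi : forall a b c,
    lie_bracket a (lie_bracket b c) + lie_bracket c (lie_bracket a b)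
    + lie_bracket b (lie_bracket c a) = 0;
  lie_alt2 : (2%:R : k) = 0 -> forall x, lie_bracket x x = 0
}.

#[short(type="lieAlgType")]
HB.structure Definition LieAlgebra (k : fieldType) :=
  {L of isLieAlgebra k L & GRing.Lmodule k L}.

Lemma lie_bracketxx (k : fieldType) (L : lieAlgType k) (x : L) :
  lie_bracket x x = 0.
Proof.
have [/lie_alt2//|nz2] := eqVneq (2%:R : k) 0.
apply: (scalerI nz2); rewrite scaler0 scaler_nat mulr2n.
exact: lie_anticomm.
Qed.

Inductive lie_term (k : fieldType) (A : Type) : Type :=
| TLetter (x : A)
| TZero
| TAdd (s t : lie_term k A)
| TScale (c : k) (t : lie_term k A)
| TBracket (s t : lie_term k A).
Arguments TLetter {k A}. Arguments TZero {k A}.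

(* The least congruence whose quotient is a Lie algebra. *)
Inductive lie_eq (k : fieldType) (A : Type) :
  lie_term k A -> lie_term k A -> Prop :=
| LE_refl s : lie_eq s s
| LE_sym s t : lie_eq s t -> lie_eq t s
| LE_trans s t u : lie_eq s t -> lie_eq t u -> lie_eq s u
| LE_add s s' t t' : lie_eq s s' -> lie_eq t t' ->
    lie_eq (TAdd s t) (TAdd s' t')
| LE_scale c s s' : lie_eq s s' -> lie_eq (TScale c s) (TScale c s')
| LE_bracket s s' t t' : lie_eq s s' -> lie_eq t t' ->
    lie_eq (TBracket s t) (TBracket s' t')
| LE_addA s t u : lie_eq (TAdd s (TAdd t u)) (TAdd (TAdd s t) u)
| LE_addC s t : lie_eq (TAdd s t) (TAdd t s)
| LE_add0 s : lie_eq (TAdd TZero s) s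
| LE_addN s : lie_eq (TAdd (TScale (-1) s) s) TZero
| LE_scaleA a b s : lie_eq (TScale a (TScale b s)) (TScale (a * b) s)
| LE_scale1 s : lie_eq (TScale 1 s) s
| LE_scaleDr a s t :
    lie_eq (TScale a (TAdd s t)) (TAdd (TScale a s) (TScale a t))
| LE_scaleDl a b s :
    lie_eq (TScale (a + b) s) (TAdd (TScale a s) (TScale b s))
| LE_bracketPl a s t u :
    lie_eq (TBracket (TAdd (TScale a s) t) u)
           (TAdd (TScale a (TBracket s u)) (TBracket t u))
| LE_bracketPr a s t u :
    lie_eq (TBracket u (TAdd (TScale a s) t))
           (TAdd (TScale a (TBracket u s)) (TBracket u t))
| LE_anticomm s t : lie_eq (TAdd (TBracket s t) (TBracket t s)) TZero
| LE_jacobi s t u :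
    lie_eq (TAdd (TAdd (TBracket s (TBracket t u)) (TBracket u (TBracket s t)))
                 (TBracket t (TBracket u s))) TZero
| LE_alt2 : (2%:R : k) = 0 -> forall s, lie_eq (TBracket s s) TZero.

HB.instance Definition _ (k : fieldType) (A : Type) :=
  gen_eqMixin (lie_term k A).
HB.instance Definition _ (k : fieldType) (A : Type) :=
  gen_choiceMixin (lie_term k A).

Section FreeLie.
Variables (k : fieldType) (A : Type).
Implicit Types s t u : lie_term k A.

Definition lie_eqb s t : bool := `[< lie_eq s t >].

Lemma lie_eqb_equiv : equiv_class_of lie_eqb.
Proof.
split=> [s|s t|t s u]; first by apply/asboolP; exact: LE_refl.
- by apply/asboolP/asboolP; apply: LE_sym.
- by move=> /asboolP st /asboolP tu; apply/asboolP; apply: LE_trans tu.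
Qed.

Canonical lie_equiv : equiv_rel (lie_term k A) := EquivRelPack lie_eqb_equiv.

Definition free_lie : Type := {eq_quot lie_equiv}.

HB.instance Definition _ := Choice.on free_lie.
HB.instance Definition _ := Quotient.on free_lie.

Lemma free_lie_piP s t : reflect (lie_eq s t) (\pi_free_lie s == \pi_free_lie t).
Proof. by rewrite piE; apply: asboolP. Qed.

Lemma free_lie_eq s t : lie_eq s t -> \pi_free_lie s = \pi_free_lie t.
Proof. by move=> st; apply/eqP/free_lie_piP. Qed.

Lemma free_lie_repr s : lie_eq (repr (\pi_free_lie s)) s.
Proof. by apply/free_lie_piP; rewrite reprK. Qed.

Definition fl_letter (x : A) : free_lie := \pi_free_lie (TLetter x).
Definition fl_zero : free_lie := \pi_free_lie TZero.
Definition fl_add (x y : free_lie) : free_lie := \pi_free_lie (TAdd (repr x) (repr y)).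
Definition fl_scale (c : k) (x : free_lie) : free_lie := \pi_free_lie (TScale c (repr x)).
Definition fl_bracket (x y : free_lie) : free_lie :=
  \pi_free_lie (TBracket (repr x) (repr y)).

Lemma fl_addE s t : fl_add (\pi_free_lie s) (\pi_free_lie t) = \pi_free_lie (TAdd s t).
Proof. by apply: free_lie_eq; apply: LE_add; apply: free_lie_repr. Qed.
Lemma fl_scaleE c s : fl_scale c (\pi_free_lie s) = \pi_free_lie (TScale c s).
Proof. by apply: free_lie_eq; apply: LE_scale; apply: free_lie_repr. Qed.
Lemma fl_bracketE s t : fl_bracket (\pi_free_lie s) (\pi_free_lie t) = \pi_free_lie (TBracket s t).
Proof. by apply: free_lie_eq; apply: LE_bracket; apply: free_lie_repr. Qed.
Definition flE := (fl_addE, fl_scaleE, fl_bracketE).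

Lemma fl_addA : associative fl_add.
Proof.
move=> x y z; elim/quotW: x => s; elim/quotW: y => t; elim/quotW: z => u.
by rewrite (fl_addE t u) (fl_addE s t) !flE; apply: free_lie_eq; apply: LE_addA.
Qed.
Lemma fl_addC : commutative fl_add.
Proof.
by elim/quotW=> s; elim/quotW=> t; rewrite !flE; apply: free_lie_eq; apply: LE_addC.
Qed.
Lemma fl_add0 : left_id fl_zero fl_add.
Proof. by elim/quotW=> s; rewrite /fl_zero !flE; apply: free_lie_eq; apply: LE_add0. Qed.
Lemma fl_addN : left_inverse fl_zero (fl_scale (-1)) fl_add.
Proof. by elim/quotW=> s; rewrite /fl_zero (fl_scaleE _ s) !flE; apply: free_lie_eq; apply: LE_addN. Qed.

HB.instance Definition _ :=
  GRing.isZmodule.Build free_lie fl_addA fl_addC fl_add0 fl_addN.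

Lemma fl_scaleA a b (x : free_lie) : fl_scale a (fl_scale b x) = fl_scale (a * b) x.
Proof. by elim/quotW: x => s; rewrite (fl_scaleE b s) !flE; apply: free_lie_eq; apply: LE_scaleA. Qed.
Lemma fl_scale1 : left_id 1 fl_scale.
Proof. by elim/quotW=> s; rewrite !flE; apply: free_lie_eq; apply: LE_scale1. Qed.
Lemma fl_scaleDr : right_distributive fl_scale +%R.
Proof.
move=> a; elim/quotW=> s; elim/quotW=> t; rewrite /GRing.add /=.
rewrite (fl_addE s t) (fl_scaleE a s) (fl_scaleE a t) !flE.
by apply: free_lie_eq; apply: LE_scaleDr.
Qed.
Lemma fl_scaleDl (x : free_lie) : {morph fl_scale^~ x : a b / a + b}.
Proof.
elim/quotW: x => s a b; rewrite [RHS]/GRing.add /= (fl_scaleE a s) (fl_scaleE b s) !flE.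
by apply: free_lie_eq; apply: LE_scaleDl.
Qed.

HB.instance Definition _ := GRing.Zmodule_isLmodule.Build k free_lie
  fl_scaleA fl_scale1 fl_scaleDr fl_scaleDl.

Lemma fl_piD s t : \pi_free_lie (TAdd s t) = \pi_free_lie s + \pi_free_lie t.
Proof. by rewrite -fl_addE. Qed.
Lemma fl_piZ c s : \pi_free_lie (TScale c s) = c *: \pi_free_lie s.
Proof. by rewrite -fl_scaleE. Qed.
Lemma fl_pi0 : \pi_free_lie TZero = 0.
Proof. by []. Qed.

Lemma fl_bracketPl (a : k) (x y z : free_lie) :
  fl_bracket (a *: x + y) z = a *: fl_bracket x z + fl_bracket y z.
Proof.
elim/quotW: x => s; elim/quotW: y => t; elim/quotW: z => u.
rewrite (fl_bracketE s u) (fl_bracketE t u) -!fl_piZ -!fl_piD fl_bracketE.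
by apply: free_lie_eq; apply: LE_bracketPl.
Qed.
Lemma fl_bracketPr (a : k) (x y z : free_lie) :
  fl_bracket z (a *: x + y) = a *: fl_bracket z x + fl_bracket z y.
Proof.
elim/quotW: x => s; elim/quotW: y => t; elim/quotW: z => u.
rewrite (fl_bracketE u s) (fl_bracketE u t) -!fl_piZ -!fl_piD fl_bracketE.
by apply: free_lie_eq; apply: LE_bracketPr.
Qed.
Lemma fl_anticomm (x y : free_lie) : fl_bracket x y + fl_bracket y x = 0.
Proof.
elim/quotW: x => s; elim/quotW: y => t.
rewrite (fl_bracketE s t) (fl_bracketE t s) -fl_piD.
by apply: free_lie_eq; apply: LE_anticomm.
Qed.
Lemma fl_jacobi (x y z : free_lie) :
  fl_bracket x (fl_bracket y z) + fl_bracket z (fl_bracket x y)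
  + fl_bracket y (fl_bracket z x) = 0.
Proof.
elim/quotW: x => s; elim/quotW: y => t; elim/quotW: z => u.
rewrite (fl_bracketE t u) (fl_bracketE s t) (fl_bracketE u s).
rewrite (fl_bracketE s) (fl_bracketE u) (fl_bracketE t) -!fl_piD.
by apply: free_lie_eq; apply: LE_jacobi.
Qed.
Lemma fl_alt2 : (2%:R : k) = 0 -> forall x : free_lie, fl_bracket x x = 0.
Proof.
move=> ch2; elim/quotW=> s; rewrite (fl_bracketE s s); apply: free_lie_eq.
exact: LE_alt2.
Qed.

HB.instance Definition _ := isLieAlgebra.Build k free_lie
  fl_bracketPl fl_bracketPr fl_anticomm fl_jacobi fl_alt2.

Lemma fl_piB s t :
  \pi_free_lie (TBracket s t) = lie_bracket (\pi_free_lie s) (\pi_free_lie t).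
Proof. by rewrite -fl_bracketE. Qed.

Fixpoint lie_eval (L : lieAlgType k) (f : A -> L) (t : lie_term k A) : L :=
  match t with
  | TLetter x => f x
  | TZero => 0
  | TAdd s t => lie_eval f s + lie_eval f t
  | TScale c t => c *: lie_eval f t
  | TBracket s t => lie_bracket (lie_eval f s) (lie_eval f t)
  end.

Lemma lie_eval_eq (L : lieAlgType k) (f : A -> L) s t :
  lie_eq s t -> lie_eval f s = lie_eval f t.
Proof.
elim=> //=.
- by move=> ? ? ? _ -> _ ->.
- by move=> ? ? ? ? _ -> _ ->.
- by move=> ? ? ? _ ->.
- by move=> ? ? ? ? _ -> _ ->.
- by move=> *; rewrite addrA.
- by move=> *; rewrite addrC.
- by move=> *; rewrite add0r.
- by move=> *; rewrite scaleN1r addNr.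
- by move=> *; rewrite scalerA.
- by move=> *; rewrite scale1r.
- by move=> *; rewrite scalerDr.
- by move=> *; rewrite scalerDl.
- by move=> *; rewrite lie_bracketPl.
- by move=> *; rewrite lie_bracketPr.
- by move=> *; rewrite lie_anticomm.
- by move=> *; rewrite lie_jacobi.
- by move=> *; rewrite lie_bracketxx.
Qed.

Definition is_lie_hom (L M : lieAlgType k) (g : L -> M) : Prop :=
  (forall (a : k) x y, g (a *: x + y) = a *: g x + g y) /\
  (forall x y, g (lie_bracket x y) = lie_bracket (g x) (g y)).

Lemma free_lie_universal (L : lieAlgType k) (f : A -> L) :
  exists2 g : free_lie -> L,
    is_lie_hom g /\ (forall x, g (fl_letter x) = f x) &
    forall h : free_lie -> L,
      is_lie_hom h -> (forall x, h (fl_letter x) = f x) -> h =1 g.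
Proof.
pose g (x : free_lie) := lie_eval f (repr x).
have gE s : g (\pi_free_lie s) = lie_eval f s.
  by apply: lie_eval_eq; apply: free_lie_repr.
have g0 (h : free_lie -> L) : is_lie_hom h -> h 0 = 0.
  by move=> [/(_ (-1) 0 0) + _]; rewrite scaler0 addr0 scaleN1r addNr.
exists g.
  split=> [|x]; last by rewrite gE.
  split=> [a x y|x y]; elim/quotW: x => s; elim/quotW: y => t.
    by rewrite -fl_piZ -fl_piD !gE.
  by rewrite -fl_piB !gE.
move=> h hH hl; have [hP hB] := hH; elim/quotW; elim=> [x||s IHs t IHt|c t IHt|s IHs t IHt].
- by rewrite gE; apply: hl.
- by rewrite gE /= fl_pi0 g0.
- rewrite gE /= -!gE -IHs -IHt fl_piD.
  by rewrite -[in LHS](scale1r (\pi_free_lie s)) hP scale1r.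
- rewrite gE /= -!gE -IHt fl_piZ -[in LHS](addr0 (c *: _)) hP.
  by rewrite g0 // addr0.
- by rewrite gE /= -!gE -IHs -IHt fl_piB hB.
Qed.

End FreeLie.
Arguments fl_letter k {A} x.

(* For w nonempty, the words [rot i w], 0 < i < size w, are the v ++ u with
   w = u ++ v, u and v nonempty. *)
Definition lyndon_shirshov (d : Order.disp_t) (A : orderType d) (w : seq A) : bool :=
  (w != [::]) &&
  all (fun i => ((w : seqlexi A) < (rot i w : seqlexi A))%O) (iota 1 (size w).-1).

Lemma lyndon_shirshovP (d : Order.disp_t) (A : orderType d) (w : seq A) :
  reflect (w <> [::] /\ forall u v : seq A, u <> [::] -> v <> [::] ->
             w = u ++ v -> ((w : seqlexi A) < (v ++ u : seqlexi A))%O)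
          (lyndon_shirshov w).
Proof.
have pos (s : seq A) : s <> [::] -> (0 < size s)%N.
  by move=> /eqP; rewrite -size_eq0 -lt0n.
apply: (iffP andP) => -[].
  move=> /eqP w0 wP; split=> // u v /pos u0 /pos v0 wE.
  have := allP wP (size u); rewrite [in rot _ _]wE rot_size_cat; apply.
  rewrite mem_iota u0 add1n prednK ?pos //.
  by rewrite wE size_cat -[X in (X < _)%N]addn0 ltn_add2l.
move=> w0 wP; split; first exact/eqP.
apply/allP => i; rewrite mem_iota add1n prednK ?pos // => /andP[i0 iw].
apply: wP; last by rewrite cat_take_drop.
  by apply/eqP; rewrite -size_eq0 size_take iw -lt0n.
by apply/eqP; rewrite -size_eq0 size_drop -lt0n subn_gt0.
Qed.

Section LeftGreedy.
Variables (T : Type) (br : T -> T -> T).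

Definition simple_word (B : eqType) (a : B) (s : seq B) : Prop :=
  exists n x, x != a /\ s = rcons (nseq n a) x.

Definition simple_partition (B : eqType) (w : seq B) (p : seq (seq B)) : Prop :=
  exists a w', [/\ w = a :: w', flatten p = w & {in p, forall s, simple_word a s}].

(* A block a^n x = [:: a; ...; a; x] is sent to [a, [a, ... [a, x]...]], where
   [ev] is the bracketing of the blocks of the previous level; the value on the
   empty block is irrelevant. *)
Definition block_bracket (B : eqType) (t0 : T) (ev : B -> T) (s : seq B) : T :=
  if s is x :: s' then foldr (fun y t => br (ev y) t) (ev (last x s')) (belast x s')
  else t0.

Lemma block_bracketE (B : eqType) t0 (ev : B -> T) n a x :
  block_bracket t0 ev (rcons (nseq n a) x) = iter n (br (ev a)) (ev x).
Proof.
case: n => [|n] //=; rewrite last_rcons belast_rcons /=; congr br.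
by elim: n => //= n ->.
Qed.

(* [left_greedy t0 ev w t]: the word w over the alphabet B, whose letters x have
   bracketings [ev x], fully partitions and t is the resulting bracketing.  The
   alphabet varies along the recursion: blocks are letters of [seq B]. *)
Inductive left_greedy (t0 : T) (B : eqType) (ev : B -> T) : seq B -> T -> Prop :=
| LG_single x : left_greedy t0 ev [:: x] (ev x)
| LG_partition w p t : simple_partition w p ->
    left_greedy t0 (block_bracket t0 ev) p t -> left_greedy t0 ev w t.

Lemma simple_partition_inj (B : eqType) (w : seq B) p q :
  simple_partition w p -> simple_partition w q -> p = q.
Proof.
move=> [a [w' [wE pw pP]]] [b [w'' [wE' qw qP]]].
move: wE'; rewrite wE => -[ab _]; subst b; move: qw; rewrite -pw => {wE w' w'' pw}.
elim: p q pP qP => [|s p IHp] [|r q] //= pP qP.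
- by have [n [x [_ ->]]] := qP r (mem_head _ _); case: n.
- by have [n [x [_ ->]]] := pP s (mem_head _ _); case: n.
have [n [x [xa sE]]] := pP s (mem_head _ _).
have [m [y [ya rE]]] := qP r (mem_head _ _).
have IH : flatten q = flatten p -> p = q.
  by apply: IHp => z zp; [apply: pP | apply: qP]; rewrite inE zp orbT.
rewrite sE rE !cat_rcons => H.
suff [nm [xy /IH ->]] : n = m /\ y = x /\ flatten q = flatten p by rewrite nm xy.
elim: n m H {sE rE} => [|n IHn] [|m] /=.
- by case.
- by move=> [ax]; rewrite ax eqxx in xa.
- by move=> [ya']; rewrite ya' eqxx in ya.
- by move=> [/IHn[-> [-> ->]]].
Qed.

Lemma left_greedy_inj (B : eqType) t0 (ev : B -> T) w t t' :
  left_greedy t0 ev w t -> left_greedy t0 ev w t' -> t = t'.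
Proof.
have single (C : eqType) (x : C) p : ~ simple_partition [:: x] p.
  move=> [a [w' [[xa w'0] pw pP]]]; subst w' a.
  case: p pw pP => [|s p] //= pw pP.
  have [n [y [yx sE]]] := pP s (mem_head _ _).
  move: pw; rewrite sE; case: n {sE} => [|[|n]] //= [xy].
  by rewrite xy eqxx in yx.
move=> H; elim: H t' => {B ev w t} [B ev x|B ev w p t wp _ IH] t' H.
  by inversion H as [|? q ? xq]; subst => //; case: (single _ _ _ xq).
inversion H as [x|? q ? wq ?]; subst; first by case: (single _ _ _ wp).
by apply: IH; rewrite (simple_partition_inj wp wq).
Qed.

(* aababb, with a = false and b = true. *)
Example left_greedy_aababb (t0 : T) (ev : bool -> T) :
  let a := ev false in let b := ev true in
  left_greedy t0 ev [:: false; false; true; false; true; true]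
    (br (br (br a (br a b)) (br a b)) b).
Proof.
move=> a b.
pose X := [:: false; false; true]; pose Y := [:: false; true]; pose Z := [:: true].
apply: (@LG_partition t0 _ _ _ [:: X; Y; Z]).
  exists false, [:: false; true; false; true; true]; split=> // s.
  by rewrite !inE => /or3P[] /eqP ->; [exists 2%N|exists 1%N|exists 0%N]; exists true.
apply: (@LG_partition t0 _ _ _ [:: [:: X; Y]; [:: Z]]).
  exists X, [:: Y; Z]; split=> // s.
  by rewrite !inE => /orP[] /eqP ->; [exists 1%N, Y|exists 0%N, Z].
apply: (@LG_partition t0 _ _ _ [:: [:: [:: X; Y]; [:: Z]]]); last exact: LG_single.
exists [:: X; Y], [:: [:: Z]]; split=> // s; rewrite inE => /eqP ->.
by exists 1%N, [:: Z].
Qed.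

End LeftGreedy.

(* Well defined by [left_greedy_inj]; 0 on words that do not fully partition. *)
Definition left_greedy_bracketing (k : fieldType) (A : eqType) (w : seq A) :
    free_lie k A :=
  xget 0 [set t | left_greedy (@lie_bracket k (free_lie k A)) 0 (fl_letter k) w t].

(* Main.v *)
(* Independence: map the free Lie algebra to noncommutative formal power series
   in the letters, with the commutator bracket.  A block [a^n x] with [a < x]
   satisfies [a (a^(n-1) x) < (a^(n-1) x) a], so by induction along the left-greedy
   bracketing the image of the bracketing of a Lyndon-Shirshov word [w] is [w] plus
   lexicographically larger words of the same length.

   Spanning: Lazard elimination.  If [a] is the minimal letter of a bracket
   monomial, then, [ad a] being a derivation, that monomial is a combination of
   bracket monomials in the elements [[a, [a, ... [a, x]]]], that is, in the
   [a]-simple words with [x <> a], and there are fewer of these than there were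
   letters.  By induction each is a combination of bracketings of Lyndon-Shirshov
   words in the [a]-simple words, and such words flatten to Lyndon-Shirshov words. *)
Require Import Defs.
From HB Require Import structures.
From mathcomp Require Import all_boot all_order all_algebra.
From mathcomp Require Import boolp classical_sets functions ring.
Set Implicit Arguments. Unset Strict Implicit. Unset Printing Implicit Defensive.
Import Order.TTheory GRing.Theory.

(** * Lexicographic comparison and Lyndon-Shirshov words *)

Section StrongLess.
Variables (d : Order.disp_t) (B : orderType d).
Implicit Types (x y a : B) (s t u v w q : seq B).
Local Open Scope order_scope.

(* Lexicographically smaller at some letter, not merely a proper prefix; unlike the
   lexicographic order, this is stable under appending arbitrary words. *)
Fixpoint sless s t : bool :=
  match s, t with
  | x :: s', y :: t' => (x < y) || (x == y) && sless s' t'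
  | _, _ => false
  end.

Lemma sless_cat s t u v : sless s t -> sless (s ++ u) (t ++ v).
Proof.
elim: s t => [|x s IHs] [|y t] //= /orP[->//|/andP[-> /IHs->]].
by rewrite orbT.
Qed.

Lemma sless_cat2l q s t : sless (q ++ s) (q ++ t) = sless s t.
Proof. by elim: q => //= x q ->; rewrite ltxx eqxx. Qed.

Lemma sless_catE s t u v : size s = size t ->
  sless (s ++ u) (t ++ v) = sless s t || (s == t) && sless u v.
Proof.
elim: s t => [|x s IHs] [|y t] //= /succn_inj /IHs ->.
by rewrite eqseq_cons -orbA andb_orr andbA.
Qed.

Lemma sless_lexi s t : sless s t -> (s : seqlexi B) < t.
Proof.
elim: s t => [|x s IHs] [|y t] //=; rewrite ltxi_cons.
by case: (ltgtP x y) => //= _ /IHs.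
Qed.

Lemma lexi_sless s t : size s = size t -> (s : seqlexi B) < t -> sless s t.
Proof.
elim: s t => [|x s IHs] [|y t] //= /succn_inj /IHs st; rewrite ltxi_cons.
by case: (ltgtP x y) => //= _ /st.
Qed.

Lemma sless_trans : transitive sless.
Proof.
move=> t s u; elim: s t u => [|x s IHs] [|y t] [|z u] //=.
move=> /orP[xy|/andP[/eqP-> st]] /orP[yz|/andP[/eqP<- tu]].
- by rewrite (lt_trans xy yz).
- by rewrite xy.
- by rewrite yz.
- by rewrite eqxx (IHs t u st tu) orbT.
Qed.

(** A word and its rotations have equal length, and there [sless] agrees with the lexicographic
    order. *)
Lemma lyndon_slessP w :
  reflect (w <> [::] /\ forall u v, u <> [::] -> v <> [::] -> w = u ++ v ->
             sless w (v ++ u))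
          (lyndon_shirshov w).
Proof.
apply: (iffP (lyndon_shirshovP w)) => -[w0 wP]; split=> // u v u0 v0 wE.
  by apply: lexi_sless; [rewrite wE !size_cat addnC|exact: wP].
by apply: sless_lexi; apply: wP.
Qed.

(** The rotation that begins at [x] is larger, so its first letter is at least [a]. *)
Lemma lyndon_head_le a w : lyndon_shirshov (a :: w) -> {in w, forall x, a <= x}.
Proof.
move=> /lyndon_slessP[_ awP] x /splitPr xw; case: xw awP => w1 w2.
move=> awP; have /orP[/ltW//|/andP[/eqP-> _//]] : sless (a :: w1 ++ x :: w2) ((x :: w2) ++ a :: w1).
exact: awP.
Qed.

(** Since [a] is minimal, moving a trailing [a] to the front cannot increase a word. This makes the
    word end where an [a]-simple block ends. *)
Lemma lyndon_last_neq a w : w != [::] -> lyndon_shirshov (a :: w) -> last a w != a.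
Proof.
have rot_ge s : {in s, forall x, a <= x} -> ~~ sless (rcons s a) (a :: s).
  elim: s => [|y s IHs] /= sa; first by rewrite ltxx andbF.
  rewrite negb_or -leNgt sa ?mem_head //=; apply/nandP.
  have [->|] := eqVneq y a; [right|by left].
  by apply: IHs => x xs; rewrite sa // inE xs orbT.
case/lastP: w => // w y _; rewrite last_rcons => awL.
apply/eqP => ya; subst y; have aw := lyndon_head_le awL.
have /negP[] : ~~ sless (rcons w a) (a :: w).
  by apply: rot_ge => x xw; apply: aw; rewrite mem_rcons inE xw orbT.
have /lyndon_slessP[_ awP] := awL.
have : sless (a :: rcons w a) ([:: a] ++ a :: w).
  by apply: awP => //; rewrite -cats1.
by rewrite /= ltxx eqxx.
Qed.

Lemma exists_min_letter s : s != [::] -> exists2 a, a \in s & {in s, forall x, a <= x}.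
Proof.
elim: s => // x [|y s] IHs _; first by exists x; rewrite ?mem_head // => y; rewrite inE => /eqP->.
have [//|a a_s aP] := IHs.
have [xa|ax] := leP x a.
  exists x; first exact: mem_head.
  by move=> z; rewrite inE => /predU1P[->//|/aP]; apply: le_trans.
exists a; first by rewrite inE a_s orbT.
by move=> z; rewrite inE => /predU1P[->|/aP//]; apply: ltW.
Qed.

End StrongLess.

(** The images of the first differing letters already differ at some letter, so whatever follows
    them is irrelevant. *)
Lemma sless_flatten_map d d' (B : orderType d) (C : orderType d')
    (phi : B -> seq C) (p q : seq B) :
  {in p & q, forall x y, (x < y)%O -> sless (phi x) (phi y)} ->
  sless p q -> sless (flatten (map phi p)) (flatten (map phi q)).
Proof.
elim: p q => [|x p IHp] [|y q] //= phiP.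
case/orP => [xy|/andP[/eqP-> pq]].
  by apply/sless_cat/phiP; rewrite ?mem_head.
rewrite sless_cat2l; apply: IHp => // u v up vq.
by apply: phiP; rewrite inE ?up ?vq orbT.
Qed.

(** * Simple words and the passage from a word to its word of blocks *)

Lemma simple_word_cons (B : eqType) (a : B) s : simple_word a s -> simple_word a (a :: s).
Proof. by move=> [n [x [xa ->]]]; exists n.+1, x. Qed.

Section SimpleBlocks.
Variables (d : Order.disp_t) (B : orderType d) (a : B).
Implicit Types (x y : B) (s t u v w : seq B) (p q : seq (seqlexi B)).
Local Open Scope order_scope.

(** An [a]-simple word stops at its first letter other than [a], so none is a proper prefix of
    another. *)
Lemma lexi_simple_sless s t :
  simple_word a s -> simple_word a t -> (s : seqlexi B) < t -> sless s t.
Proof.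
move=> [n [x [xa ->]]] [m [y [ya ->]]].
elim: n m => [|n IHn] [|m]; rewrite /= ltxi_cons.
- by rewrite andbF orbF; case: (ltgtP x y).
- by case: (ltgtP x a) xa => //= ->.
- by case: (ltgtP a y) ya => //= ->; rewrite eqxx.
- by rewrite lexx ltxx eqxx /=; apply: IHn.
Qed.

Lemma sless_simple_flatten p q :
  {in p, forall s, simple_word a s} -> {in q, forall s, simple_word a s} ->
  sless p q -> sless (flatten p) (flatten q).
Proof.
move=> pP qP pq; rewrite -[p]map_id -[q]map_id.
by apply: sless_flatten_map pq => s t /pP + /qP; apply: lexi_simple_sless.
Qed.

Lemma flatten_simple_eq0 p :
  {in p, forall s, simple_word a s} -> flatten p = [::] -> p = [::].
Proof.
case: p => // s p pP; have [n [x [_ ->]]] := pP s (mem_head _ _).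
by case: n.
Qed.

(** Each block holds exactly one letter other than [a]. Hence the word of blocks is shorter whenever
    [a] occurs, which drives the inductions on length. *)
Lemma size_simple_partition p :
  {in p, forall s, simple_word a s} -> size p = count (predC1 a) (flatten p).
Proof.
elim: p => //= s p IHp pP; rewrite count_cat -IHp; last first.
  by move=> t tp; apply: pP; rewrite inE tp orbT.
have [n [x [xa ->]]] := pP s (mem_head _ _).
by rewrite -cats1 count_cat count_nseq /= eqxx xa mul0n.
Qed.

Lemma simple_partition_exists w : last a w != a ->
  exists2 p, flatten p = w & {in p, forall s, simple_word a s}.
Proof.
(* The induction must reach the empty tail, which the hypothesis excludes because [last a [::]] is
   [a]. *)
move=> wa; have {wa} : (w == [::]) || (last a w != a) by rewrite wa orbT.
elim: w => [|x w IHw] /=; first by exists [::].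
have [->{x}|xa] := eqVneq x a => wa.
  have [|p pw pP] := IHw; first by rewrite wa orbT.
  case: p pw pP wa => [<-|s p <- pP _]; first by rewrite /= eqxx.
  exists ((a :: s) :: p) => // t; rewrite inE => /predU1P[->|tp].
    by apply: simple_word_cons; apply: pP; rewrite mem_head.
  by apply: pP; rewrite inE tp orbT.
have [|p pw pP] := IHw; first by case: (w) wa => //.
exists ([:: x] :: p); first by rewrite /= pw.
by move=> t; rewrite inE => /predU1P[->|/pP//]; exists 0, x.
Qed.

(** Rotations of [p] flatten to rotations of [flatten p], and flattening is strictly monotone on
    [a]-simple blocks; a rotation of [p] not above [p] would thus flatten to one not above
    [flatten p]. *)
Lemma lyndon_simple_blocks p : {in p, forall s, simple_word a s} ->
  lyndon_shirshov (flatten p) -> lyndon_shirshov p.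
Proof.
move=> pP /lyndon_slessP[w0 wP]; apply/lyndon_slessP; split=> [p0|p1 p2 p10 p20 pE].
  by apply: w0; rewrite p0.
have pP1 : {in p1, forall s, simple_word a s}.
  by move=> s sp; apply: pP; rewrite pE mem_cat sp.
have pP2 : {in p2, forall s, simple_word a s}.
  by move=> s sp; apply: pP; rewrite pE mem_cat sp orbT.
have wlt : (flatten p : seqlexi B) < flatten (p2 ++ p1).
  rewrite flatten_cat; apply/sless_lexi/wP.
  - by move=> /(flatten_simple_eq0 pP1).
  - by move=> /(flatten_simple_eq0 pP2).
  - by rewrite pE flatten_cat.
have pP21 : {in p2 ++ p1, forall s, simple_word a s}.
  by move=> s; rewrite mem_cat => /orP[/pP2|/pP1].
have szE : size p = size (p2 ++ p1) by rewrite pE !size_cat addnC.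
case: (ltgtP (p : seqlexi (seqlexi B)) (p2 ++ p1)).
- exact: lexi_sless.
- move=> /(lexi_sless (esym szE)) /(sless_simple_flatten pP21 pP) /sless_lexi.
  by move=> /(lt_trans wlt); rewrite ltxx.
- by move=> pE'; move: wlt; rewrite [in X in X < _]pE' ltxx.
Qed.

End SimpleBlocks.

(** * Flattening Lyndon-Shirshov words of blocks *)

Lemma flatten_eq_cat (T : Type) (p : seq (seq T)) (u v : seq T) :
  flatten p = u ++ v ->
  (exists p1 p2, [/\ p = p1 ++ p2, u = flatten p1 & v = flatten p2]) \/
  (exists p1 s1 s2 p2, [/\ s1 <> [::], s2 <> [::], p = p1 ++ (s1 ++ s2) :: p2,
     u = flatten p1 ++ s1 & v = s2 ++ flatten p2]).
Proof.
elim: p u => [|s p IHp] u /= E.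
  by case: u v E => [|//] [|//] _; left; exists [::], [::].
have [su|us] := leqP (size s) (size u).
  have us : u = s ++ drop (size s) u.
    rewrite -[LHS](cat_take_drop (size s)); congr cat.
    by have := congr1 (take (size s)) E; rewrite take_size_cat // takel_cat.
  move: E; rewrite us -catA => /(congr1 (drop (size s))).
  rewrite !drop_size_cat // => /IHp [[p1 [p2 [-> -> ->]]]|].
    by left; exists (s :: p1), p2.
  move=> [p1 [s1 [s2 [p2 [s10 s20 -> -> ->]]]]].
  by right; exists (s :: p1), s1, s2, p2; rewrite /= catA.
have sE : s = u ++ drop (size u) s.
  rewrite -[LHS](cat_take_drop (size u)); congr cat.
  by have := congr1 (take (size u)) E; rewrite (takel_cat _ (ltnW us)) take_size_cat.
have vE : v = drop (size u) s ++ flatten p.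
  move: E; rewrite {1}sE -catA => /(congr1 (drop (size u))).
  by rewrite !drop_size_cat.
have [u0|u0] : u = [::] \/ u <> [::] by case: (u); [left|right].
  by left; exists [::], (s :: p); rewrite vE u0 drop0.
right; exists [::], u, (drop (size u) s), p; split=> //; last by rewrite /= -sE.
by move=> /(congr1 size); rewrite size_drop /= => /eqP; rewrite subn_eq0 leqNgt us.
Qed.

Section FlattenLyndon.
Variables (d : Order.disp_t) (B : orderType d) (a : B).
Implicit Types (x y : B) (s t u v w : seq B) (p q : seq (seqlexi B)).
Local Open Scope order_scope.

(** The suffix of [a^n x] is [a^m x] with [m < n]; the two first differ where [a] meets the larger
    letter [x]. *)
Lemma simple_word_suffix s1 s2 : {in s1 ++ s2, forall x, a <= x} ->
  simple_word a (s1 ++ s2) -> s1 <> [::] -> s2 <> [::] ->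
  simple_word a s2 /\ sless (s1 ++ s2) s2.
Proof.
move=> + [n [x [xa sE]]]; rewrite sE => ge_a s10 s20.
have ax : a < x by rewrite lt_neqAle eq_sym xa ge_a // mem_rcons mem_head.
have {ge_a} lt_n j : sless (a :: rcons (nseq j a) x) (rcons (nseq j a) x).
  by elim: j => [|j IHj] /=; rewrite ?ax // ltxx eqxx.
have sle j i : sless (rcons (nseq (i.+1 + j) a) x) (rcons (nseq j a) x).
  elim: i => [|i IHi]; first exact: lt_n.
  exact: sless_trans (lt_n _) IHi.
elim: n s1 s10 sE => [|n IHn] [|y [|z s1]] //= _ [].
- by move=> _ s2E; case: s20.
- move=> _ ->; split; first by exists n, x.
  exact: lt_n.
move=> _ sE; have [//|] := IHn (z :: s1) _ sE.
move=> [m [x' [xa' s2E]]] lt2; split; first by exists m, x'.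
exact: sless_trans (lt_n n) lt2.
Qed.

(** A rotation by whole blocks is compared in the word of blocks. A cut inside a block makes the
    rotation begin with a proper suffix of it, which is [a]-simple and larger than that block, hence
    larger than the first block, the least one. *)
Lemma lyndon_flatten p : {in p, forall s, simple_word a s} ->
  {in flatten p, forall x, a <= x} -> lyndon_shirshov p ->
  lyndon_shirshov (flatten p).
Proof.
move=> pP ge_a pL; have [p0 pLP] := lyndon_slessP _ pL.
apply/lyndon_slessP; split=> [/(flatten_simple_eq0 pP)//|u v u0 v0 /[dup] wE].
move=> /flatten_eq_cat[[p1 [p2 [pE uE vE]]]|].
  rewrite uE vE -flatten_cat; apply: (@sless_simple_flatten _ _ a) => //.
    by move=> s sp; apply: pP; rewrite pE mem_cat orbC -mem_cat.
  by apply: pLP => // p'0; [apply: u0|apply: v0]; rewrite ?uE ?vE p'0.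
move=> [p1 [s1 [s2 [p2 [s10 s20 pE uE vE]]]]].
have s12p : s1 ++ s2 \in p by rewrite pE mem_cat mem_head orbT.
have [||//|//|s2P s12lt] := @simple_word_suffix s1 s2.
- by move=> x xs; apply: ge_a; apply/flattenP; exists (s1 ++ s2).
- exact: pP.
case: (p) p0 pL pP s12p => // s0 p' _ pL pP s12p.
have s0lt : (s0 : seqlexi B) < s2.
  apply: le_lt_trans (sless_lexi s12lt).
  by move: s12p; rewrite inE => /predU1P[->//|]; exact: (lyndon_head_le pL).
rewrite vE -catA /=; apply: sless_cat.
by apply: (@lexi_simple_sless _ _ a) s0lt => //; apply: pP; rewrite mem_head.
Qed.

(** A block containing [a] starts with [a], hence so does the first block, which is the least.
    [simple_partition] requires its pivot to be the first letter. *)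
Lemma head_flatten_lyndon p : {in p, forall s, simple_word a s} ->
  {in flatten p, forall x, a <= x} -> lyndon_shirshov p -> a \in flatten p ->
  exists w, flatten p = a :: w.
Proof.
move=> pP ge_a pL /flattenP[s sp a_s].
case: p pP ge_a pL sp => // s0 p pP ge_a pL sp.
have s0s : (s0 : seqlexi B) <= s.
  by move: sp; rewrite inE => /predU1P[->//|]; exact: (lyndon_head_le pL).
have [n [x [xa sE]]] := pP s sp.
have [m [y [ya s0E]]] := pP s0 (mem_head _ _).
case: m s0E => [|m] s0E; last by rewrite s0E; eexists.
case: n sE => [|n] sE; first by move: a_s xa; rewrite sE inE => /eqP->; rewrite eqxx.
move: s0s; rewrite s0E sE /= lexi_cons => /andP[y_a _].
have a_y : a <= y by apply: ge_a; rewrite s0E mem_head.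
by move: ya; rewrite (le_anti (_ : y <= a <= y)) ?y_a ?a_y ?eqxx.
Qed.

End FlattenLyndon.

(** * Linear spans *)

Section Span.
Variables (k : fieldType) (V : lmodType k).
Local Open Scope ring_scope.

Inductive lspan (S : V -> Prop) : V -> Prop :=
| lspan0 : lspan S 0
| lspan_cons c x y : S x -> lspan S y -> lspan S (c *: x + y).

Lemma lspan_gen (S : V -> Prop) x : S x -> lspan S x.
Proof. by move=> Sx; rewrite -[x]scale1r -[_ *: _]addr0; apply: lspan_cons Sx (lspan0 _). Qed.

Lemma lspanD S x y : lspan S x -> lspan S y -> lspan S (x + y).
Proof.
by move=> Sx Sy; elim: Sx => [|c {}x z Sx _ IH]; rewrite ?add0r // -addrA; apply: lspan_cons.
Qed.

Lemma lspanZ S c x : lspan S x -> lspan S (c *: x).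
Proof.
elim=> [|a {}x y Sx _ IH]; first by rewrite scaler0; apply: lspan0.
by rewrite scalerDr scalerA; apply: lspan_cons.
Qed.

Lemma lspan_bind (S S' : V -> Prop) x :
  (forall y, S y -> lspan S' y) -> lspan S x -> lspan S' x.
Proof.
move=> SS'; elim=> [|c {}x y /SS' Sx _ IH]; first exact: lspan0.
by apply: lspanD => //; apply: lspanZ.
Qed.

Lemma lspan_linear_combination (I : eqType) (b : I -> V) v :
  lspan (fun x => exists i, x = b i) v ->
  exists (s : seq I) (c : I -> k), v = \sum_(i <- s) c i *: b i.
Proof.
(* Coefficients depend on the index only, so the list is kept duplicate-free: a generator already
   listed just changes its coefficient. *)
move=> vS; suff [s [c [_ ->]]] : exists (s : seq I) (c : I -> k),
  uniq s /\ v = \sum_(i <- s) c i *: b i by exists s, c.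
elim: vS => [|a x y [i ->] _ [s [c [us ->]]]].
  by exists [::], (fun=> 0); rewrite big_nil.
have [i_s|i_s] := boolP (i \in s).
  exists s, (fun j => (if j == i then a else 0) + c j); split=> //.
  under [RHS]eq_bigr do rewrite scalerDl.
  rewrite big_split /=; congr (_ + _).
  rewrite (bigD1_seq i) //= eqxx big1 ?addr0 // => j /negPf->.
  by rewrite scale0r.
exists (i :: s), (fun j => if j == i then a else c j); split; first by rewrite /= i_s.
rewrite big_cons eqxx; congr (_ + _); apply: eq_big_seq => j js.
by case: eqP => // ji; rewrite -ji js in i_s.
Qed.

End Span.

(** * Bracket monomials and elimination of the least letter *)

Section LieAlgebraTheory.
Variables (k : fieldType) (L : lieAlgType k).
Local Open Scope ring_scope.
Implicit Types x y z : L.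

Lemma lie_bracketDr x y z : lie_bracket x (y + z) = lie_bracket x y + lie_bracket x z.
Proof. by rewrite -[y in LHS]scale1r lie_bracketPr scale1r. Qed.
Lemma lie_bracketDl x y z : lie_bracket (y + z) x = lie_bracket y x + lie_bracket z x.
Proof. by rewrite -[y in LHS]scale1r lie_bracketPl scale1r. Qed.
Lemma lie_bracket0r x : lie_bracket x 0 = 0.
Proof. by apply: (addIr (lie_bracket x 0)); rewrite -lie_bracketDr !add0r. Qed.
Lemma lie_bracket0l x : lie_bracket 0 x = 0.
Proof. by apply: (addIr (lie_bracket 0 x)); rewrite -lie_bracketDl !add0r. Qed.
Lemma lie_bracketZr c x y : lie_bracket x (c *: y) = c *: lie_bracket x y.
Proof. by rewrite -[c *: y]addr0 lie_bracketPr lie_bracket0r addr0. Qed.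
Lemma lie_bracketZl c x y : lie_bracket (c *: x) y = c *: lie_bracket x y.
Proof. by rewrite -[c *: x]addr0 lie_bracketPl lie_bracket0l addr0. Qed.
Lemma lie_bracketC x y : lie_bracket x y = - lie_bracket y x.
Proof. by apply/eqP; rewrite -addr_eq0 lie_anticomm. Qed.

Lemma lie_bracket_derivation x y z :
  lie_bracket x (lie_bracket y z) =
  lie_bracket (lie_bracket x y) z + lie_bracket y (lie_bracket x z).
Proof.
apply/eqP; rewrite -subr_eq0 opprD addrA -(lie_jacobi x y z).
rewrite (lie_bracketC (lie_bracket x y)) opprK.
by rewrite (lie_bracketC z x) -(scaleN1r (lie_bracket x z)) lie_bracketZr scaleN1r.
Qed.

Lemma lspan_bracket (S1 S2 S3 : L -> Prop) x y :
  (forall u v, S1 u -> S2 v -> lspan S3 (lie_bracket u v)) ->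
  lspan S1 x -> lspan S2 y -> lspan S3 (lie_bracket x y).
Proof.
move=> S123 Sx Sy; elim: Sx => [|c {}x z Sx _ IH].
  by rewrite lie_bracket0l; apply: lspan0.
rewrite lie_bracketPl; apply: lspanD IH; apply: lspanZ.
elim: Sy => [|e {}y t Sy _ IH]; first by rewrite lie_bracket0r; apply: lspan0.
by rewrite lie_bracketPr; apply: lspanD IH; apply: lspanZ; apply: S123.
Qed.

(** The list of letters is an index because the value in [L] does not determine it. *)
Inductive lie_mono (B : Type) (ev : B -> L) : seq B -> L -> Prop :=
| lie_mono_letter (b : B) : lie_mono ev [:: b] (ev b)
| lie_mono_bracket s t u v : lie_mono ev s u -> lie_mono ev t v ->
    lie_mono ev (s ++ t) (lie_bracket u v).

Lemma lie_mono_neq0 (B : Type) (ev : B -> L) s v : lie_mono ev s v -> s <> [::].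
Proof. by elim=> // {}s t u {}v _ + _ _; case: s. Qed.

Section Elimination.
Variables (B : eqType) (a : B) (ev : B -> L).
Let ev' := block_bracket (@lie_bracket k L) 0 ev.

(** Letters are tracked up to permutation, since [ad a] may insert [a] into any block. *)
Definition block_mono (s : seq B) (v : L) : Prop :=
  exists p, [/\ lie_mono ev' p v, {in p, forall t, simple_word a t} &
               perm_eq (flatten p) s].

Lemma block_mono_perm s t v : perm_eq s t -> block_mono s v -> block_mono t v.
Proof. by move=> st [p [pv pP ps]]; exists p; rewrite (permPl ps). Qed.

Lemma block_mono_bracket s t u v :
  block_mono s u -> block_mono t v -> block_mono (s ++ t) (lie_bracket u v).
Proof.
move=> [p [pu pP ps]] [q [qv qP qt]]; exists (p ++ q); split.
- exact: lie_mono_bracket.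
- by move=> r; rewrite mem_cat => /orP[/pP|/qP].
- by rewrite flatten_cat perm_cat.
Qed.

(** The derivation rule carries [ad a] down to single blocks, where [[a, ev' t]] is by definition
    the bracketing of the block [a :: t]. *)
Lemma block_mono_ad s v :
  block_mono s v -> lspan (block_mono (a :: s)) (lie_bracket (ev a) v).
Proof.
move=> [p [pv pP ps]]; elim: pv s pP ps => [t|p1 p2 u1 u2 v1 IH1 v2 IH2] s pP ps.
  apply: lspan_gen; exists [:: a :: t]; split.
  - have -> : lie_bracket (ev a) (ev' t) = ev' (a :: t).
      have [n [x [_ ->]]] := pP t (mem_head _ _).
      by rewrite -[a :: _]/(rcons (nseq n.+1 a) x) /ev' !block_bracketE.
    exact: lie_mono_letter.
  - by move=> r; rewrite inE => /eqP->; apply: simple_word_cons; apply: pP; rewrite mem_head.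
  - by rewrite /= perm_cons.
have p1P : {in p1, forall t, simple_word a t}.
  by move=> r rp; apply: pP; rewrite mem_cat rp.
have p2P : {in p2, forall t, simple_word a t}.
  by move=> r rp; apply: pP; rewrite mem_cat rp orbT.
rewrite flatten_cat in ps.
rewrite lie_bracket_derivation; apply: lspanD.
  apply: lspan_bracket (IH1 _ p1P (perm_refl _)) (lspan_gen (x := u2) (S := eq u2) erefl).
  move=> u z Hu <-; apply: lspan_gen; apply: block_mono_perm (block_mono_bracket Hu _).
    by rewrite /= perm_cons; exact: ps.
  by exists p2.
apply: lspan_bracket (lspan_gen (x := u1) (S := eq u1) erefl) (IH2 _ p2P (perm_refl _)).
move=> u z <- Hz; apply: lspan_gen; apply: block_mono_perm (block_mono_bracket _ Hz).
  rewrite -cat1s perm_catCA /= perm_cons; exact: ps.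
by exists p1.
Qed.

(* The first alternative covers the monomials in which only [a] occurs. *)
Lemma lazard_elimination s v : lie_mono ev s v ->
  (exists c, v = c *: ev a /\ (c = 0 \/ s = [:: a])) \/ lspan (block_mono s) v.
Proof.
elim=> [x|s1 s2 u1 u2 _ IH1 _ IH2].
  have [->|xa] := eqVneq x a; first by left; exists 1; rewrite scale1r; split=> //; right.
  right; apply: lspan_gen; exists [:: [:: x]]; split=> //.
    exact: lie_mono_letter.
  by move=> t; rewrite inE => /eqP->; exists 0%N, x.
case: IH1 IH2 => [[c1 [-> c1P]]|IH1] [[c2 [-> c2P]]|IH2].
(* Both factors are multiples of [ev a], so the bracket vanishes. *)
- left; exists 0; rewrite scale0r lie_bracketZl lie_bracketZr lie_bracketxx !scaler0.
  by split=> //; left.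
- rewrite lie_bracketZl; case: c1P => [->|->].
    by left; exists 0; rewrite !scale0r; split=> //; left.
  right; apply: lspanZ.
  apply: lspan_bracket (lspan_gen (x := ev a) (S := eq (ev a)) erefl) IH2.
  by move=> u z <-; apply: block_mono_ad.
- rewrite lie_bracketZr; case: c2P => [->|->].
    by left; exists 0; rewrite !scale0r; split=> //; left.
  right; apply: lspanZ; rewrite lie_bracketC -scaleN1r; apply: lspanZ.
  apply: lspan_bracket (lspan_gen (x := ev a) (S := eq (ev a)) erefl) IH1.
  move=> u z <- /block_mono_ad; apply: lspan_bind => y Hy; apply: lspan_gen.
  by apply: block_mono_perm Hy; rewrite perm_sym perm_catC.
- right; apply: lspan_bracket IH1 IH2 => u z Hu Hz; apply: lspan_gen.
  exact: block_mono_bracket.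
Qed.

End Elimination.

(** Keeping [perm_eq w s] in the conclusion ensures that, one level up, the letters of the words
    obtained are [a]-simple and that [a] still occurs after flattening. *)
Lemma lie_mono_span d (B : orderType d) (ev : B -> L) s v : lie_mono ev s v ->
  lspan (fun t => exists w, [/\ perm_eq w s, lyndon_shirshov w &
                               left_greedy (@lie_bracket k L) 0 ev w t]) v.
Proof.
(* The alphabet varies with the induction: the blocks are the letters of the next level. *)
have [n] := ubnP (size s); elim: n => // n IHn in d B ev s v *.
rewrite ltnS => sn sv.
have [|a a_s a_min] := @exists_min_letter _ _ s.
  by apply/eqP; apply: lie_mono_neq0 sv.
case: (lazard_elimination a sv) => [[c [-> [->|->]]]|].
- by rewrite scale0r; apply: lspan0.
- by apply/lspanZ/lspan_gen; exists [:: a]; split=> //; apply: LG_single.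
apply: lspan_bind => z [p [pz pP ps]].
have pn : (size p < n)%N.
  apply: leq_trans sn; rewrite (size_simple_partition pP) (permP ps).
  by rewrite -(count_predC (pred1 a) s) -[X in (X < _)%N]add0n ltn_add2r -has_count has_pred1.
apply: lspan_bind (IHn _ (seqlexi B) _ p z pn pz) => t [q [qp qL qt]].
apply: lspan_gen; exists (flatten q).
have qP : {in q, forall r, simple_word a r}.
  by move=> r; rewrite (perm_mem qp); apply: pP.
have qs : perm_eq (flatten q) s.
  by apply: perm_trans ps; apply: perm_flatten.
have q_min : {in flatten q, forall b : B, (a <= b)%O}.
  by move=> b; rewrite (perm_mem qs); apply: a_min.
have [|w wE] := head_flatten_lyndon qP q_min qL; first by rewrite (perm_mem qs).
split=> //; first exact: lyndon_flatten qP q_min qL.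
by apply: LG_partition qt; exists a, w.
Qed.

End LieAlgebraTheory.

(** * The Lie algebra of noncommutative power series *)

Section Series.
Variables (k : fieldType) (A : eqType).
Local Open Scope ring_scope.

(* Noncommutative formal power series, as coefficient functions on words. *)
Definition series : Type := seq A -> k.

HB.instance Definition _ := GRing.Lmodule.copy series (seq A -> k^o).

Implicit Types (f g h : series) (u v w : seq A).

Lemma seriesD f g w : (f + g) w = f w + g w. Proof. by []. Qed.
Lemma seriesZ c f w : (c *: f) w = c * f w. Proof. by []. Qed.
Lemma series0 w : (0 : series) w = 0. Proof. by []. Qed.
Lemma series_sum (I : Type) (s : seq I) (F : I -> series) w :
  (\sum_(i <- s) F i) w = \sum_(i <- s) F i w.
Proof. by elim/big_rec2: _ => // i x y _ <-. Qed.

(** The concatenation product: the sum of [f u * g v] over all factorizations [w = u ++ v]. *)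
Fixpoint conv f g w : k :=
  if w is x :: w' then f [::] * g w + conv (fun u => f (x :: u)) g w'
  else f [::] * g [::].

Lemma conv_linearl c f g h w :
  conv (fun u => c * f u + g u) h w = c * conv f h w + conv g h w.
Proof.
elim: w f g => [|x w IHw] f g /=; first by rewrite mulrDl mulrA.
by rewrite IHw mulrDl mulrDr mulrA addrACA.
Qed.

Lemma conv_linearr c f g h w :
  conv h (fun u => c * f u + g u) w = c * conv h f w + conv h g w.
Proof.
elim: w h => [|x w IHw] h /=; first by rewrite mulrDr mulrCA.
by rewrite IHw mulrDr mulrDr mulrCA addrACA.
Qed.

Lemma convA f g h w : conv f (conv g h) w = conv (conv f g) h w.
Proof.
elim: w f g => [|x w IHw] f g /=; first by rewrite mulrA.
(* By definition [conv f g (x :: u)] is [f [::] * g (x :: u)] plus a product with [f] shifted by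
   [x], the form that [conv_linearl] takes. *)
by rewrite conv_linearl mulrDr mulrA IHw addrA.
Qed.

(** At most one factorization has a left factor of length [n]; if [w] is shorter, [take n w] is [w]
    and both sides vanish. *)
Lemma conv_homogeneous n f g w : (forall u, size u != n -> f u = 0) ->
  conv f g w = f (take n w) * g (drop n w).
Proof.
elim: n f w => [|n IHn] f [|x w] fn //=.
- set h := fun u => f (x :: u).
  suff -> : conv h g w = 0 by rewrite addr0.
  (* Writing the zero series as [-h + h] lets linearity kill the product. *)
  have h0 : h =1 (fun u => (-1) * h u + h u) by move=> u; rewrite mulN1r addNr /h fn.
  by rewrite (funext h0) conv_linearl mulN1r addNr.
- by rewrite fn // !mul0r add0r IHn // => u un; apply: fn.
Qed.

Definition commutator f g : series := fun w => conv f g w - conv g f w.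

Lemma commutatorPl c f g h :
  commutator (c *: f + g) h = c *: commutator f h + commutator g h.
Proof.
apply/funext => w; rewrite seriesD seriesZ /commutator conv_linearl conv_linearr.
by rewrite opprD mulrBr addrACA.
Qed.

Lemma commutatorPr c f g h :
  commutator h (c *: f + g) = c *: commutator h f + commutator h g.
Proof.
apply/funext => w; rewrite seriesD seriesZ /commutator conv_linearl conv_linearr.
by rewrite opprD mulrBr addrACA.
Qed.

Lemma commutator_anticomm f g : commutator f g + commutator g f = 0.
Proof. by apply/funext => w; rewrite seriesD /commutator addrC subrKA subrr. Qed.

Lemma commutator_jacobi f g h :
  commutator f (commutator g h) + commutator h (commutator f g)
  + commutator g (commutator h f) = 0.
Proof.
have convBl f1 f2 f3 w : conv (fun u => f1 u - f2 u) f3 w = conv f1 f3 w - conv f2 f3 w.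
  have -> : (fun u => f1 u - f2 u) = (fun u => (-1) * f2 u + f1 u).
    by apply/funext => u; rewrite mulN1r addrC.
  by rewrite conv_linearl mulN1r addrC.
have convBr f1 f2 f3 w : conv f3 (fun u => f1 u - f2 u) w = conv f3 f1 w - conv f3 f2 w.
  have -> : (fun u => f1 u - f2 u) = (fun u => (-1) * f2 u + f1 u).
    by apply/funext => u; rewrite mulN1r addrC.
  by rewrite conv_linearr mulN1r addrC.
apply/funext => w; rewrite !seriesD /commutator !convBl !convBr !convA.
by rewrite series0; ring.
Qed.

HB.instance Definition _ := isLieAlgebra.Build k series
  commutatorPl commutatorPr commutator_anticomm commutator_jacobi
  (fun _ f => funext (fun w => subrr (conv f f w))).

End Series.

(** * Leading words of left-greedy bracketings *)

Section Leading.
Variables (k : fieldType) (d : Order.disp_t) (A : orderType d).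
Implicit Types (f g : series k A) (u v w : seq A).
Local Open Scope ring_scope.

(** The least word of [f] is [w], with coefficient 1. Homogeneity is included so that leading words
    multiply. *)
Definition leads f w : Prop :=
  [/\ f w = 1, forall u, size u != size w -> f u = 0 & forall u, sless u w -> f u = 0].

Lemma leads_lexi f w u : leads f w -> ((u : seqlexi A) < w)%O -> f u = 0.
Proof.
move=> [_ f_size f_less] uw; have [su|/f_size//] := eqVneq (size u) (size w).
exact/f_less/lexi_sless.
Qed.

(** By homogeneity only the cut at [size u] contributes, and words of equal length cut there are
    compared part by part. *)
Lemma leads_conv f g u v : leads f u -> leads g v -> leads (conv f g) (u ++ v).
Proof.
move=> [fu f_size f_less] [gv g_size g_less].
have convE w : conv f g w = f (take (size u) w) * g (drop (size u) w).
  exact: conv_homogeneous.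
split=> [|w|w wuv]; rewrite convE.
- by rewrite take_size_cat // drop_size_cat // fu gv mulr1.
- rewrite size_cat => sw.
  have [s1|/f_size->] := eqVneq (size (take (size u) w)) (size u); last by rewrite mul0r.
  rewrite [X in _ * X]g_size ?mulr0 //; apply: contraNneq sw => s2.
  by rewrite -[w](cat_take_drop (size u)) size_cat s1 s2.
- have [s1|/f_size->] := eqVneq (size (take (size u) w)) (size u); last by rewrite mul0r.
  move: wuv; rewrite -[X in sless X](cat_take_drop (size u)) sless_catE //.
  by case/orP => [/f_less->|/andP[_ /g_less->]]; rewrite ?mul0r ?mulr0.
Qed.

(** The subtracted product leads with the larger word [v ++ u], so it vanishes at [u ++ v] and
    below. *)
Lemma leads_bracket f g u v : sless (u ++ v) (v ++ u) ->
  leads f u -> leads g v -> leads (lie_bracket f g) (u ++ v).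
Proof.
move=> uv_vu fu gv.
have [fg1 fg_size fg_less] := leads_conv fu gv.
have [_ gf_size gf_less] := leads_conv gv fu.
have brE w : lie_bracket f g w = conv f g w - conv g f w by [].
split=> [|w sw|w wuv]; rewrite brE.
- by rewrite fg1 gf_less ?subr0.
- by rewrite fg_size // gf_size ?subr0 // size_cat addnC -size_cat.
- by rewrite fg_less // gf_less ?subr0 //; apply: sless_trans uv_vu.
Qed.

Lemma leads_letter x : leads (fun w => (w == [:: x])%:R : k) [:: x].
Proof.
split=> [|w|w]; first by rewrite eqxx.
- by case: (w =P [:: x]) => // ->; rewrite eqxx.
- by case: (w =P [:: x]) => // ->; rewrite /= ltxx andbF.
Qed.

Variables (L : lieAlgType k) (g : L -> series k A).
Hypothesis gB : forall x y, g (lie_bracket x y) = lie_bracket (g x) (g y).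

Lemma leads_block d' (B : orderType d') (ev : B -> L) (phi : B -> seq A) (a x : B) n :
  sless (phi a) (phi x) -> leads (g (ev a)) (phi a) -> leads (g (ev x)) (phi x) ->
  leads (g (iter n (lie_bracket (ev a)) (ev x)))
        (flatten (map phi (rcons (nseq n a) x))).
Proof.
move=> ax La Lx; elim: n => [|n IHn]; first by rewrite /= cats0.
rewrite /= gB; apply: leads_bracket => //.
(* Cancelling the [n] common copies of [phi a] leaves [phi a ++ phi x] against [phi x ++ phi a]. *)
elim: n {IHn} => [|n IHn] /=; first by rewrite cats0 sless_cat.
by rewrite -[X in sless _ X]catA sless_cat2l.
Qed.

(** With [phi x] the leading word of the value of [x], the statement passes from letters to blocks,
    whose leading words are concatenations. The induction also shows that [w] fully partitions. *)
Lemma left_greedy_leads d' (B : orderType d') (ev : B -> L) (phi : B -> seq A)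
    (w : seq B) :
  {in w &, forall x y, (x < y)%O -> sless (phi x) (phi y)} ->
  {in w, forall x, leads (g (ev x)) (phi x)} ->
  lyndon_shirshov w ->
  exists2 t, left_greedy (@lie_bracket k L) 0 ev w t &
             leads (g t) (flatten (map phi w)).
Proof.
have [n] := ubnP (size w); elim: n => // n IHn in d' B ev phi w *.
case: w => [|a [|b w]] // wn phi_less phi_leads wL.
  exists (ev a); first exact: LG_single.
  by rewrite /= cats0; apply: phi_leads; rewrite mem_head.
have a_min := lyndon_head_le wL.
have wa : last a (b :: w) != a by apply: lyndon_last_neq wL.
have [p pw pP] : exists2 p, flatten p = a :: b :: w & {in p, forall s, simple_word a s}.
  exact: simple_partition_exists.
have in_block s : s \in p -> {subset s <= a :: b :: w}.
  by move=> sp x xs; rewrite -pw; apply/flattenP; exists s.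
have a_in : a \in a :: b :: w by rewrite mem_head.
pose phi' (s : seqlexi B) := flatten (map phi s).
have phi'_less : {in p &, forall s t, (s < t)%O -> sless (phi' s) (phi' t)}.
  move=> s t sp tp /(lexi_simple_sless (pP _ sp) (pP _ tp)).
  by apply: sless_flatten_map => x y /(in_block _ sp) xw /(in_block _ tp) yw; apply: phi_less.
have phi'_leads : {in p, forall s,
    leads (g (block_bracket (@lie_bracket k L) 0 ev s)) (phi' s)}.
  move=> s sp; have [m [x [xa sE]]] := pP s sp.
  have xw : x \in a :: b :: w by apply: (in_block s sp); rewrite sE mem_rcons mem_head.
  rewrite {1}sE block_bracketE /phi' sE; apply: leads_block; [|exact: phi_leads..].
  apply: phi_less => //; rewrite lt_neqAle eq_sym xa /=.
  by move: xw; rewrite inE => /predU1P[->//|/a_min].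
(* The first letter [a] is not counted, so there are fewer blocks than letters. *)
have pn : (size p < n)%N.
  apply: leq_trans (_ : size (a :: b :: w) <= n)%N => //; rewrite (size_simple_partition pP) pw /= eqxx add0n.
  exact: (count_size _ (b :: w)).
have pL : lyndon_shirshov (p : seq (seqlexi B)).
  by apply: lyndon_simple_blocks pP _; rewrite pw.
have [t pt tL] := IHn _ (seqlexi B) _ phi' p pn phi'_less phi'_leads pL.
exists t; first by apply: LG_partition pt; exists a, (b :: w).
suff <- : flatten (map phi' p) = flatten (map phi (a :: b :: w)) by [].
by rewrite -pw; elim: (p) => //= s q IHq; rewrite map_cat flatten_cat -IHq.
Qed.

End Leading.

(** * Linear independence and spanning *)

Theorem corollary5p2 (k : fieldType) (d : Order.disp_t) (A : orderType d) :
  linear_basis (fun w : {w : seq A | lyndon_shirshov w} =>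
    left_greedy_bracketing k (val w)).
Proof.
have bracketingE (w : seq A) t :
    left_greedy (@lie_bracket k (free_lie k A)) 0%R (fl_letter k) w t ->
    left_greedy_bracketing k w = t.
  by move=> wt; apply: xget_unique => // t' wt'; apply: left_greedy_inj wt' wt.
split.
  have [g [[gP gB] g_letter] _] :=
    free_lie_universal (fun x : A => (fun w => (w == [:: x])%:R%R) : series k A).
  have bracketing_leads (w : {w : seq A | lyndon_shirshov w}) :
      leads (g (left_greedy_bracketing k (val w))) (val w).
    have [|x _|t wt] := @left_greedy_leads k d A _ g gB d A (fl_letter k)
      (fun x => [:: x]) (val w) _ _ (valP w).
    - by move=> x y _ _ /= ->.
    - by rewrite g_letter; apply: leads_letter.
    by rewrite (bracketingE _ _ wt) flatten_map1 map_id.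
  have g0 : g 0%R = 0%R.
    by have := gP (-1)%R 0%R 0%R; rewrite scaler0 addr0 scaleN1r addNr.
  move=> s c us sum0.
  have {sum0} gsum0 : (\sum_(i <- s) c i *: g (left_greedy_bracketing k (val i)) = 0)%R.
    transitivity (g (\sum_(i <- s) c i *: left_greedy_bracketing k (val i))%R); last first.
      by rewrite sum0.
    elim: (s) => [|i r IHr]; first by rewrite !big_nil g0.
    by rewrite !big_cons gP IHr.
  move=> i0 i0s; apply: contrapT => /eqP ci0.
  (* Let [val i] be the least word with nonzero coefficient. Every other term either has coefficient
     zero or leads with a larger word, so the coefficient of the sum at [val i] is [c i]. *)
  pose r := [seq i <- s | c i != 0%R].
  have [|m /mapP[i ir ->] m_min] := @exists_min_letter _ (seqlexi A) (map val r).
    have : i0 \in r by rewrite mem_filter ci0.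
    by case: (r).
  move: ir; rewrite mem_filter => /andP[/eqP ci is_]; apply: ci.
  have := congr1 (fun f : series k A => f (val i)) gsum0.
  rewrite series_sum (bigD1_seq i) //= seriesZ.
  have [-> _ _] := bracketing_leads i; rewrite mulr1 big_seq_cond big1 ?addr0 //.
  move=> j /andP[js ji]; rewrite seriesZ.
  have [->|cj] := eqVneq (c j) 0%R; first by rewrite mul0r.
  rewrite (leads_lexi (bracketing_leads j)) ?mulr0 //.
  rewrite lt_neqAle (inj_eq val_inj) eq_sym ji /= m_min //.
  by apply: map_f; rewrite mem_filter cj.
move=> v; apply: lspan_linear_combination.
(* Bilinearity of the bracket reduces arbitrary terms to bracket monomials in the letters. *)
suff : lspan (fun x => exists s, lie_mono (fl_letter k) s x) v.
  apply: lspan_bind => {}v [s /lie_mono_span]; apply: lspan_bind => t [w [_ wL wt]].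
  by apply: lspan_gen; exists (exist _ w wL); rewrite (bracketingE _ _ wt).
elim/quotW: v; elim=> [x||s IHs t IHt|c t IHt|s IHs t IHt].
- by apply: lspan_gen; exists [:: x]; apply: lie_mono_letter.
- exact: lspan0.
- by rewrite fl_piD; apply: lspanD.
- by rewrite fl_piZ; apply: lspanZ.
- rewrite fl_piB; apply: lspan_bracket IHs IHt => x y [s' sx] [t' ty].
  by apply: lspan_gen; exists (s' ++ t'); apply: lie_mono_bracket.
Qed.
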